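(* Let $\mu \in \mathscr{W}(\mathbb{R}^n)$ be a measure with distribution function $f$. Generalized $\vec{v}$-Ehrhard symmetrization with respect to $\mu$ preserves measurability. That is, for any $\mathcal{L}^n$-measurable set $E \subset \mathbb{R}^n$ and any direction $\vec{v} \in \mathbb{S}^{n-1}$, $S_{\vec{v}}(E)$ is an $\mathcal{L}^n$-measurable set.
   Context: $\mathscr{W}(\mathbb{R}^n)$ is the class of measures $\mu=f\mathcal{L}^n$ whose distribution function (density) $f$ is non-negative and in $L^1(\mathbb{R}^n)\cap W^{1,1}_{\mathrm{loc}}(\mathbb{R}^n)$; $f$ is always taken to be its precise representative (the limit as $r\to0$ of its averages over $B_r(x)$ where this limit exists, $0$ elsewhere). Generalized Ehrhard symmetrization. In dimension one, for $\mu=f\mathcal{L}^1$ with $0\le f\in L^1(\mathbb{R})$, $\vec v\in\{-1,1\}$ and $E\subset\mathbb{R}$ measurable, $S_{\vec v}(E)=E^s_{\vec v}:=\{x:\vec v\cdot x\ge c\}$, where $c\in\mathbb{R}\cup\{\pm\infty\}$ is the smallest constant such that $\mu(E)=\mu(S_{\vec v}(E))$. In dimension $n$, for $\vec v\in\mathbb{S}^{n-1}$, let $\pi_{\vec v^\perp}$ be the orthogonal projection onto $\vec v^\perp$, and for $x\in\vec v^\perp$ let $E_x=E\cap\pi_{\vec v^\perp}^{-1}(x)$. Then $S_{\vec v}(E)=E^s_{\vec v}:=\bigcup_{x\in\vec v^\perp}(E_x)^s_{\vec v}$, where the line $\pi_{\vec v^\perp}^{-1}(x)=\{x+t\vec v:t\in\mathbb{R}\}$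 is identified with $\mathbb{R}$ (with direction $\vec v$) and $(E_x)^s_{\vec v}$ is the one-dimensional symmetrization with respect to $\mu_x:=f\mathcal{H}^1$ restricted to $\pi_{\vec v^\perp}^{-1}(x)$. (This makes sense for $\mathcal{H}^{n-1}$-a.e. $x$; the exceptional fibers form an $\mathcal{L}^n$-null set.) *)

(* Defs.v *)
From HB Require Import structures.
From mathcomp Require Import all_boot all_order all_algebra.
From mathcomp Require Import all_classical all_reals all_analysis.

Set Implicit Arguments.
Unset Strict Implicit.
Unset Printing Implicit Defensive.
Import Order.TTheory GRing.Theory Num.Theory.
Import numFieldNormedType.Exports.

Local Open Scope classical_set_scope.
Local Open Scope ring_scope.

(* R^n is 'rV[R]_n.  Its library topology is the usual one, but its library
   norm `|x| is the sup norm, so the Euclidean norm is defined separately. *)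
Definition dotv (R : realType) (n : nat) (x y : 'rV[R]_n) : R :=
  \sum_(i < n) x 0 i * y 0 i.

Definition enorm (R : realType) (n : nat) (x : 'rV[R]_n) : R :=
  Num.sqrt (dotv x x).

Definition eball (R : realType) (n : nat) (x : 'rV[R]_n) (r : R) :
  set 'rV[R]_n := [set y | enorm (y - x) < r].

(* The product (= Borel) sigma-algebra of R^n. *)
Definition rV_display : measure_display.
Proof. exact: default_measure_display. Qed.

Section measurable_rV.
Context {R : realType}.
Variable n : nat.

Definition coordv (i : 'I_n) (x : 'rV[R]_n) : R := x 0 i.

Let rV_set0 : g_sigma_preimage coordv set0.
Proof. exact: sigma_algebra0. Qed.

Let rV_setC A : g_sigma_preimage coordv A -> g_sigma_preimage coordv (~` A).
Proof. exact: sigma_algebraC. Qed.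

Let rV_bigcup (F : _^nat) : (forall i, g_sigma_preimage coordv (F i)) ->
  g_sigma_preimage coordv (\bigcup_i (F i)).
Proof. exact: sigma_algebra_bigcup. Qed.

HB.instance Definition _ := @isMeasurable.Build rV_display
  'rV[R]_n (g_sigma_preimage coordv) rV_set0 rV_setC rV_bigcup.

End measurable_rV.

Section consv.
Context {R : realType}.
Variable n : nat.

Definition consv (p : measurableTypeR R * 'rV[R]_n) : 'rV[R]_n.+1 :=
  \row_i (if unlift ord0 i is Some j then p.2 0 j else p.1).

Definition unconsv (x : 'rV[R]_n.+1) : measurableTypeR R * 'rV[R]_n :=
  (x 0 ord0, \row_j x 0 (lift ord0 j)).

Lemma consvK : cancel consv unconsv.
Proof.
move=> [a x]; rewrite /unconsv /consv mxE unlift_none; congr pair.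
by apply/rowP => j; rewrite !mxE liftK.
Qed.

End consv.

Lemma measurable_coordv (R : realType) (n : nat) (i : 'I_n) :
  measurable_fun [set: 'rV[R]_n] (@coordv R n i).
Proof.
move=> _ Y mY; rewrite setTI; apply: sub_sigma_algebra => /=.
rewrite -bigcup_seq/=; exists i => /=; first by rewrite mem_index_enum.
by exists Y => //; rewrite setTI.
Qed.

Lemma measurable_fun_coordvP (R : realType) (n : nat) (d : measure_display)
    (T : measurableType d) (f : T -> 'rV[R]_n) :
  (forall i, measurable_fun [set: T] (@coordv R n i \o f)) ->
  measurable_fun [set: T] f.
Proof.
move=> mf _ A mA; rewrite setTI.
suff : g_sigma_preimage (fun i => @coordv R n i \o f) `<=` measurable.
  by apply; rewrite g_sigma_preimage_comp; exists A; rewrite ?setTI.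
apply: smallest_sub; first exact: sigma_algebra_measurable.
rewrite -bigcup_seq => B [i _] [C mC <-].
exact: mf.
Qed.

Lemma measurable_consv (R : realType) (n : nat) :
  measurable_fun setT (@consv R n).
Proof.
apply: measurable_fun_coordvP => i.
case: (unliftP ord0 i) => [j ->|->].
- rewrite (_ : _ \o _ = coordv j \o snd).
    by apply: measurableT_comp => //; exact: measurable_coordv.
  by apply/funext => p; rewrite /= /coordv mxE liftK.
- rewrite (_ : _ \o _ = fst); first exact: measurable_fst.
  by apply/funext => p; rewrite /= /coordv mxE unlift_none.
Qed.

Lemma measurable_unconsv (R : realType) (n : nat) :
  measurable_fun setT (@unconsv R n).
Proof.
apply/measurable_fun_pairP; split; first exact: measurable_coordv.
apply: measurable_fun_coordvP => i.
rewrite (_ : _ \o _ = coordv (lift ord0 i)); first exact: measurable_coordv.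
by apply/funext => x; rewrite /= /coordv /= mxE.
Qed.

Section borel_lebesgue.
Context {R : realType}.

Definition lebesgue_succ (n : nat)
    (m : {sigma_finite_measure set 'rV[R]_n -> \bar R}) :
    set 'rV[R]_n.+1 -> \bar R :=
  pushforward (lebesgue_measure \x m)%E (@consv R n).

Section instances.
Variables (n : nat) (m : {sigma_finite_measure set 'rV[R]_n -> \bar R}).

Let lebesgue_succ0 : lebesgue_succ m set0 = 0%E.
Proof. by rewrite /lebesgue_succ /pushforward preimage_set0 measure0. Qed.

Let lebesgue_succ_ge0 A : (0 <= lebesgue_succ m A)%E.
Proof. by rewrite /lebesgue_succ /pushforward; exact: measure_ge0. Qed.

Let lebesgue_succ_sigma_additive : semi_sigma_additive (lebesgue_succ m).
Proof.
have mC A : measurable A -> measurable (@consv R n @^-1` A).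
  by move=> mA; rewrite -[X in measurable X]setTI; exact: measurable_consv.
move=> F mF tF mUF; rewrite /lebesgue_succ /pushforward preimage_bigcup.
apply: measure_semi_sigma_additive.
- by move=> k; exact: mC.
- apply/trivIsetP => /= i j _ _ ij; rewrite -preimage_setI.
  by move/trivIsetP : tF => /(_ _ _ _ _ ij) ->//; rewrite preimage_set0.
- by rewrite -preimage_bigcup; exact: mC.
Qed.

HB.instance Definition _ := isMeasure.Build _ _ _ (lebesgue_succ m)
  lebesgue_succ0 lebesgue_succ_ge0 lebesgue_succ_sigma_additive.

Let lebesgue_succ_sigma_finite : sigma_finite setT (lebesgue_succ m).
Proof.
have /sigma_finiteP[F [TF ndF Foo]] := sigma_finiteT (@lebesgue_measure R).
have /sigma_finiteP[G [TG ndG Goo]] := sigma_finiteT m.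
exists (fun k => @unconsv R n @^-1` (F k `*` G k)).
  rewrite -preimage_bigcup (_ : \bigcup_k _ = setT) ?preimage_setT//.
  rewrite predeqE => -[x y]; split => // _.
  have [k _ Fkx] : (\bigcup_k F k) x by rewrite -TF.
  have [l _ Gly] : (\bigcup_k G k) y by rewrite -TG.
  exists (maxn k l) => //; split => /=.
  - by move: x Fkx; exact/subsetPset/ndF/leq_maxl.
  - by move: y Gly; exact/subsetPset/ndG/leq_maxr.
move=> k; have [mFk Fkoo] := Foo k; have [mGk Gkoo] := Goo k; split.
  rewrite -[X in measurable X]setTI; apply: measurable_unconsv => //.
  exact: measurableX.
rewrite /lebesgue_succ /pushforward -comp_preimage.
rewrite (_ : _ \o _ = id) ?preimage_id; last first.
  by apply/funext => p; exact: consvK.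
by rewrite product_measure1E// lte_mul_pinfty// ge0_fin_numE.
Qed.

HB.instance Definition _ := @Measure_isSigmaFinite.Build _ _ _
  (lebesgue_succ m) lebesgue_succ_sigma_finite.

End instances.

(* The n-fold product of the Lebesgue measure of R, on Borel sets. *)
Fixpoint borel_lebesgue (n : nat) :
    {sigma_finite_measure set 'rV[R]_n -> \bar R} :=
  if n is k.+1 then lebesgue_succ (borel_lebesgue k) else \d_(0 : 'rV[R]_0).

End borel_lebesgue.

Lemma borel_lebesgue_box (R : realType) (n : nat) (a b : 'rV[R]_n) :
  (forall i, a 0 i <= b 0 i) ->
  borel_lebesgue n [set x : 'rV[R]_n | forall i, x 0 i \in `]a 0 i, b 0 i]] =
  (\prod_(i < n) (b 0 i - a 0 i))%:E.
Proof.
elim: n a b => [|n IH] a b ab.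
  rewrite big_ord0 /= diracE mem_set//=; by case.
rewrite big_ord_recl /= /lebesgue_succ /pushforward.
pose tl (x : 'rV[R]_n.+1) : 'rV[R]_n := \row_j x 0 (lift ord0 j).
rewrite (_ : _ @^-1` _ = (`]a 0 ord0, b 0 ord0]%classic : set (measurableTypeR R)) `*` [set x : 'rV[R]_n | forall i, x 0 i \in `](tl a) 0 i, (tl b) 0 i]]); last first.
  apply/seteqP; split => [[x y] /= H|[x y] /= [Hx Hy] i].
    split; first by have := H ord0; rewrite mxE unlift_none.
    by move=> i; have := H (lift ord0 i); rewrite !mxE liftK.
  case: (unliftP ord0 i) => [j ->|->]; rewrite mxE ?liftK ?unlift_none//=.
  by have := Hy j; rewrite !mxE.
rewrite product_measure1E.
- rewrite IH; last by move=> i; rewrite !mxE.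
  rewrite (_ : _ (`]a 0 ord0, b 0 ord0]%classic) = (b 0 ord0 - a 0 ord0)%:E); last first.
    transitivity (lebesgue_measure (`]a 0 ord0, b 0 ord0]%classic : set R)) => //.
    rewrite lebesgue_measure_itv/= lte_fin; case: (ltP (a 0 ord0)) => // h.
    have -> : b 0 ord0 = a 0 ord0 by apply/eqP; rewrite eq_le h ab.
    by rewrite subrr.
  rewrite -EFinM; congr (_ * _)%:E.
  by apply: eq_bigr => i _; rewrite !mxE.
- exact: measurable_itv.
- rewrite (_ : mkset _ = \bigcap_(i in setT) (@coordv R n i @^-1` `](tl a) 0 i, (tl b) 0 i]%classic)).
    apply: fin_bigcap_measurable => // i _.
    by rewrite -[X in measurable X]setTI; apply: measurable_coordv.
  apply/seteqP; split => x /= H i; [move=> _; have := H i | have := H i Logic.I]; by rewrite /= /coordv ?mem_setE ?inE ?set_itvE ?in_itv /=.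
Qed.

(* The completion of [borel_lebesgue]; its measurable sets are the
   Caratheodory-measurable ones, as for the library's
   [completed_lebesgue_measure] on R. *)
Definition lebRn (R : realType) (n : nat) : Type :=
  caratheodory_type ((@borel_lebesgue R n)^*)%mu.

HB.instance Definition _ (R : realType) (n : nat) :=
  Measurable.on (lebRn R n).

Definition lebesgue (R : realType) (n : nat) :
    {measure set (lebRn R n) -> \bar R} :=
  @completed_measure_extension _ _ _ (@borel_lebesgue R n).

Definition lebesgue_measurable (R : realType) (n : nat) (E : set 'rV[R]_n) :=
  measurable (E : set (lebRn R n)).

Section sobolev.
Variables (R : realType) (n : nat).
Implicit Types (f g phi : 'rV[R]_n -> R) (i : 'I_n).

Definition partial i phi : 'rV[R]_n -> R := 'D_(delta_mx 0 i) phi.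

Fixpoint class_C (k : nat) phi : Prop :=
  if k is k'.+1 then
    forall i, (forall x, derivable phi x (delta_mx 0 i)) /\
              class_C k' (partial i phi)
  else continuous phi.

Definition test_function phi : Prop :=
  (forall k, class_C k phi) /\ compact (closure [set x | phi x != 0]).

Definition loc_integrable f : Prop :=
  forall K : set 'rV[R]_n, compact K ->
    (lebesgue R n).-integrable K (EFin \o f).

Definition weak_partial i f g : Prop :=
  forall phi, test_function phi ->
    \int[lebesgue R n]_x (f x * partial i phi x) =
    - \int[lebesgue R n]_x (g x * phi x).

Definition W11_loc f : Prop :=
  loc_integrable f /\
  forall i, exists2 g, loc_integrable g & weak_partial i f g.

Definition ball_average f (x : 'rV[R]_n) (r : R) : R :=
  (fine (lebesgue R n (eball x r)))^-1 *
  \int[lebesgue R n]_(y in eball x r) f y.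

Definition precise_representative f (x : 'rV[R]_n) : R :=
  if `[< cvg (ball_average f x r @[r --> 0^'+]) >]
  then lim (ball_average f x r @[r --> 0^'+]) else 0.

(* [W_class mu f]: mu belongs to W(R^n), with distribution function f. *)
Definition W_class (mu : {measure set (lebRn R n) -> \bar R}) f : Prop :=
  [/\ forall A : set (lebRn R n), measurable A ->
         mu A = (\int[lebesgue R n]_(x in A) (f x)%:E)%E,
      forall x, 0 <= f x,
      (lebesgue R n).-integrable setT (EFin \o f),
      W11_loc f &
      precise_representative f = f].

End sobolev.

Definition is_smallest (R : realType) (C : set (\bar R)) (c : \bar R) : Prop :=
  C c /\ lbound C c.

Definition density_measure (R : realType) (g : R -> R) (A : set R) : \bar R :=
  (\int[completed_lebesgue_measure]_(t in A) (g t)%:E)%E.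

Definition half_line (R : realType) (s : R) (c : \bar R) : set R :=
  [set t | (c <= (s * t)%:E)%E].

(* One-dimensional symmetrization of E with respect to g L^1 in the direction
   s = 1 or s = -1.  The smallest c is unique when it exists; when none exists,
   which can only happen if g is not integrable or E is not measurable, the
   result is empty. *)
Definition ehrhard_sym1 (R : realType) (g : R -> R) (s : R) (E : set R) :
    set R :=
  [set t | exists2 c : \bar R,
     is_smallest [set c | density_measure g E =
                          density_measure g (half_line s c)] c &
     half_line s c t].

Definition orthv (R : realType) (n : nat) (v : 'rV[R]_n) : set 'rV[R]_n :=
  [set x | dotv x v = 0].

(* For |v| = 1, t |-> x + t v is an isometry of R onto the fibre through x, so
   it carries L^1 to H^1 restricted to the fibre. *)
Definition ehrhard_sym (R : realType) (n : nat) (f : 'rV[R]_n -> R)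
    (v : 'rV[R]_n) (E : set 'rV[R]_n) : set 'rV[R]_n :=
  \bigcup_(x in orthv v)
    [set x + t *: v | t in ehrhard_sym1 (fun t : R => f (x + t *: v)) 1
                             [set t : R | E (x + t *: v)]].

(* Main.v *)
Require Import Defs.
From mathcomp Require Import all_boot all_order all_algebra.
From mathcomp Require Import all_classical all_reals all_analysis.
From mathcomp Require Import measurable_realfun ring lra.

(** Write [line v x] for the parametrized line s |-> x + s v.  For a point y,
    let t be the coordinate of y along v.  On the fibre through y the
    symmetrized set is a half-line [c, +oo[, where c is the smallest level whose
    tail carries the mass of E, and y belongs to it exactly when c <= t.  As
    tails decrease, this happens exactly when the tail starting at y carries no
    more mass than E does on the whole line:
      int_(s >= 0) f (y + s v) ds  <=  int_(y + s v in E) f (y + s v) ds.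
    If f and E are Borel, both sides are Borel functions of y by Tonelli's
    theorem, so the symmetrized set is Borel.  The level c is eliminated from
    the description, so no measurable selection is needed; one only has to know
    that it exists ([exists_smallest_tail]), which holds as soon as f is
    integrable along the line, since then the mass of a tail depends
    continuously on its end point, +oo and -oo included ([cvg_tail]).

    The general case differs from the Borel one by null sets.  Off a Borel null
    set N, E agrees with a Borel set B and f with a Borel function g
    ([caratheodory_eq_off], [measurable_version]).  The fibre through y is
    harmless when it meets N in a one-dimensional null set and g is integrable
    along it, and almost every y has these two properties
    ([ae_null_lines], [ae_fin_line_integral]).  So the symmetrized set agrees
    off a null set with a Borel set, and it is measurable because the
    completed measure sees all subsets of null sets ([eq_off_caratheodory]).

    Fubini's theorem in the direction v would normally ask for a rotation taking
    v to a basis vector.  This is avoided by integrating over pairs (s, x) in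
    R x R^n and using that x |-> x + s v preserves Lebesgue measure for each
    fixed s ([ge0_integral_lines]): every line is then counted infinitely often,
    which is of no consequence for null sets, and for the integrability of g it
    is cured by restricting x to slabs transverse to v. *)

Set Implicit Arguments.
Unset Strict Implicit.
Unset Printing Implicit Defensive.
Import Order.TTheory GRing.Theory Num.Theory.
Import numFieldNormedType.Exports.

Local Open Scope classical_set_scope.
Local Open Scope ring_scope.

(** * Measurable sets and functions of a completed measure *)

Definition eq_off (T : Type) (N A B : set T) := forall x, ~ N x -> (A x <-> B x).

Section completion.
Context d (T : measurableType d) (R : realType).
Variable mu : {measure set T -> \bar R}.
Local Open Scope ereal_scope.
Local Notation mu_out := (mu^*)%mu.
Local Notation cT := (caratheodory_type mu_out).

(** The outer measure is an infimum over Borel covers; the intersection of a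
    minimizing sequence of covers attains it. *)
Lemma measurable_hull (X : set T) :
  exists H, [/\ measurable H, X `<=` H & mu H = mu_out X].
Proof.
have [U [mU XU muU]] : exists U : (set T)^nat, [/\ forall n, measurable (U n),
    forall n, X `<=` U n & (fun n => mu (U n)) @ \oo --> mu_out X].
  pose S := [set \sum_(k <oo) mu (A k) | A in measurable_cover X].
  have S0 : S != set0.
    apply/set0P; exists (\sum_(k <oo) mu setT), (fun=> setT) => //.
    by split => // x _; exists 0%N.
  have [u uS ucvg] := ereal_inf_seq S0.
  have [A AP] : {A : (nat -> set T)^nat & forall n, measurable_cover X (A n) /\
      \sum_(k <oo) mu (A n k) = u n}.
    by apply: (@choice _ _ (fun n B => measurable_cover X B /\
      \sum_(k <oo) mu (B k) = u n)) => n; have [B ? ?] := uS n; exists B.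
  have mU n : measurable (\bigcup_k A n k).
    by apply: bigcupT_measurable => k; exact: (AP n).1.1.
  exists (fun n => \bigcup_k A n k); split => //.
    by move=> n; exact: (AP n).1.2.
  apply: (squeeze_cvge _ (@cvg_cst _ (mu_out X) _ _ _) ucvg).
  apply: nearW => n; rewrite -(AP n).2 -measurable_mu_extE//.
  apply/andP; split; first exact: le_mu_ext (AP n).1.2.
  rewrite measurable_mu_extE//; apply: measure_sigma_subadditive => //.
  by move=> k; exact: (AP n).1.1.
exists (\bigcap_n U n); have mI : measurable (\bigcap_n U n).
  exact: bigcapT_measurable.
split => //; first by move=> x Xx n _; exact: XU.
apply/eqP; rewrite eq_le; apply/andP; split; last first.
  rewrite -(measurable_mu_extE mu)//; apply: le_mu_ext => x Xx n _; exact: XU.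
apply: (cvg_ge_lim muU) || rewrite -(cvg_lim _ muU)//.
apply: lime_ge; first by apply/cvg_ex; exists (mu_out X).
by apply: nearW => n; apply: le_measure; rewrite ?inE//; exact: bigcap_inf.
Qed.

(** Where the measure is finite, a Caratheodory-measurable set differs from its
    hull by a set of outer measure zero, whose own hull is then a Borel null
    set; sigma-finiteness glues the pieces. *)
Lemma caratheodory_eq_off (E : set T) : sigma_finite setT mu ->
  mu_out.-cara.-measurable E ->
  exists B N, [/\ measurable B, measurable N, mu N = 0 & eq_off N E B].
Proof.
move=> [S ST mS] mE.
pose E_ i := E `&` S i.
have mcS i : mu_out.-cara.-measurable (S i).
  exact: caratheodory_measurable_mu_ext (mS i).1.
have [F FP] : {F : (set T)^nat & forall i,
    [/\ measurable (F i), E_ i `<=` F i & mu (F i) = mu_out (E_ i)]}.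
  by apply: (@choice _ _ (fun i H => [/\ measurable H, E_ i `<=` H &
    mu H = mu_out (E_ i)])) => i; exact: measurable_hull.
have mcF i : mu_out.-cara.-measurable (F i).
  by apply: caratheodory_measurable_mu_ext; case: (FP i).
have [G GP] : {G : (set T)^nat & forall i,
    [/\ measurable (G i), F i `\` E_ i `<=` G i & mu (G i) = mu_out (F i `\` E_ i)]}.
  by apply: (@choice _ _ (fun i H => [/\ measurable H, F i `\` E_ i `<=` H &
    mu H = mu_out (F i `\` E_ i)])) => i; exact: measurable_hull.
have mcE i : mu_out.-cara.-measurable (E_ i).
  by apply: (@measurableI _ cT).
have G0 i : mu (G i) = 0.
  case: (GP i) => _ _ ->; case: (FP i) => mFi EF FE.
  have Efin : mu_out (E_ i) < +oo.
    apply: le_lt_trans (mS i).2; rewrite -(measurable_mu_extE mu); last exact: (mS i).1.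
    by apply: le_mu_ext => x [].
  have FEfin : mu_out (F i) < +oo by rewrite measurable_mu_extE// FE.
  have -> : mu_out (F i `\` E_ i) = mu_out (F i) - mu_out (F i `&` E_ i).
    exact: (@measureD _ cT R (@completed_measure_extension _ _ _ mu)
      (F i) (E_ i) (mcF i) (mcE i) FEfin).
  rewrite (measurable_mu_extE mu mFi) FE.
  by rewrite setIidr// subee// ge0_fin_numE//; exact: mu_ext_ge0.
exists (\bigcup_i F i), (\bigcup_i G i); split.
- by apply: bigcupT_measurable => i; case: (FP i).
- by apply: bigcupT_measurable => i; case: (GP i).
- have /negligibleP : mu.-negligible (\bigcup_i G i).
    apply: negligible_bigcup => i; apply/negligibleP; last exact: G0.
    by case: (GP i).
  by apply; apply: bigcupT_measurable => i; case: (GP i).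
- move=> x NG; split => [Ex|[i _ Fx]].
    have [i _ Sx] : (\bigcup_i S i) x by rewrite -ST.
    by exists i => //; case: (FP i) => _ + _; apply.
  apply: contrapT => nEx; apply: NG; exists i => //.
  by case: (GP i) => _ + _; apply; split => // -[].
Qed.

(** The converse of [caratheodory_eq_off], from the completeness of the
    Caratheodory measure. *)
Lemma eq_off_caratheodory (E B N : set T) : measurable B -> measurable N ->
  mu N = 0 -> eq_off N E B -> mu_out.-cara.-measurable E.
Proof.
move=> mB mN N0 EB.
have mcara (A : set T) : measurable A -> @measurable _ cT A.
  exact: caratheodory_measurable_mu_ext.
have mcN A : A `<=` N -> @measurable _ cT A.
  move=> AN; apply: measure_is_complete_caratheodory; exists N; split => //.
    exact: mcara.
  by rewrite /= measurable_mu_extE.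
have -> : E = (B `\` N) `|` (E `&` N).
  apply/seteqP; split => [x Ex|x [[Bx Nx]|[]//]]; last exact/EB.
  have [Nx|Nx] := pselect (N x); [by right|left; split => //].
  by apply/EB.
apply: (@measurableU _ cT); last exact: mcN.
by apply: mcara; exact: measurableD.
Qed.

(** A nonnegative f is the supremum of q 1_(f > q) over the rationals q, so it
    suffices to replace each of these countably many level sets by a Borel
    version. *)
Lemma measurable_version (f : cT -> R) : sigma_finite setT mu ->
  measurable_fun setT f -> (forall x, 0 <= f x)%R ->
  exists h : T -> R, exists N, [/\ measurable_fun setT h, measurable N, mu N = 0,
    forall x, (0 <= h x)%R & forall x, ~ N x -> f x = h x].
Proof.
move=> sf mf f0.
(* Indices coding no rational give q = 0, and 0 is a lower bound of f. *)
pose q (n : nat) : R := if @unpickle rat n is Some a then ratr a else 0%R.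
have mF n : mu_out.-cara.-measurable [set x : T | (q n < f x)%R].
  rewrite (_ : mkset _ = setT `&` f @^-1` `]q n, +oo[%classic); first exact: mf.
  by rewrite setTI; apply/seteqP; split => x /=; rewrite in_itv/= andbT.
have [B BP] : {B : (set T)^nat & forall n, exists N, [/\ measurable (B n),
    measurable N, mu N = 0 & eq_off N [set x : T | (q n < f x)%R] (B n)]}.
  apply: (@choice _ _ (fun n B => exists N, [/\ measurable B,
    measurable N, mu N = 0 & eq_off N [set x : T | (q n < f x)%R] B])) => n.
  exact: caratheodory_eq_off.
have [N NP] : {N : (set T)^nat & forall n, [/\ measurable (B n),
    measurable (N n), mu (N n) = 0 & eq_off (N n) [set x : T | (q n < f x)%R] (B n)]}.
  exact: (@choice _ _ (fun n N => [/\ measurable (B n),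
    measurable N, mu N = 0 & eq_off N [set x : T | (q n < f x)%R] (B n)])).
pose g (n : nat) (x : T) : \bar R := (q n * \1_(B n) x)%:E.
have mg n : measurable_fun setT (g n).
  apply/measurable_EFinP; apply: measurable_funM => //.
  by apply: measurable_indic; case: (BP n) => ? [].
pose h (x : T) : R := fine (esups (g ^~ x) 0%N).
(* The supremum is nonnegative only off the null set; the maximum with 0 makes
   the Borel version nonnegative everywhere. *)
exists (fun x => Num.max 0 (h x))%R, (\bigcup_n N n); split.
- apply: measurable_maxr => //; apply: measurableT_comp => //.
  exact: measurable_fun_esups.
- by apply: bigcupT_measurable => n; case: (NP n).
- have /negligibleP : mu.-negligible (\bigcup_i N i).
    apply: negligible_bigcup => i; case: (NP i) => ? ? ? _.
    exact/negligibleP.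
  by apply; apply: bigcupT_measurable => i; case: (NP i).
- by move=> x; rewrite le_max lexx.
- move=> x nN; suff -> : h x = f x by rewrite max_r.
  suff : esups (g ^~ x) 0%N = (f x)%:E by rewrite /h => ->.
  have BE n : B n x <-> (q n < f x)%R.
    have [_ _ _ NE] := NP n.
    by apply: iff_sym; apply: NE => Nx; apply: nN; exists n.
  apply/eqP; rewrite eq_le; apply/andP; split.
    apply: ge_ereal_sup => _ [n _ <-]; rewrite /g lee_fin indicE.
    have [/set_mem/BE/ltW|_] := boolP (x \in B n); first by rewrite mulr1.
    by rewrite mulr0.
  have gn (a : rat) : (0 < ratr a :> R)%R -> (ratr a < f x)%R ->
      (ratr a)%:E <= esups (g ^~ x) 0%N.
    move=> a0 afx; apply: ereal_sup_ubound; exists (pickle a) => //=.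
    have qa : q (pickle a) = ratr a by rewrite /q pickleK.
    by rewrite /g indicE mem_set ?mulr1 ?qa//; apply/BE; rewrite qa.
  have [fx0|fx0] := leP (f x) 0%R.
    have fx : f x = 0%R by apply/eqP; rewrite eq_le fx0 f0.
    rewrite fx; apply: ereal_sup_ubound; exists (pickle (0 : rat)%R) => //=.
    by rewrite /g /q pickleK rmorph0 mul0r.
  apply/lee_subgt0Pr => e e0.
  have /rat_in_itvoo[a] : (Num.max 0 (f x - e) < f x)%R.
    by rewrite gt_max fx0/= gtrBl.
  rewrite in_itv/= gt_max => /andP[/andP[a0 ea] af].
  by apply: le_trans (gn a a0 af); rewrite -EFinB lee_fin ltW.
Qed.

End completion.

Lemma ge0_integral_preserving d d' (T : measurableType d) (T' : measurableType d')
    (R : realType) (mu : {measure set T -> \bar R})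
    (mu' : {measure set T' -> \bar R}) (j : T' -> T) (f : T -> \bar R) (D : set T) :
  measurable_fun setT j ->
  (forall C, measurable C -> mu' (j @^-1` C) = mu C) ->
  measurable D -> measurable_fun setT f -> (forall x, 0 <= f x)%E ->
  (\int[mu']_(x in j @^-1` D) f (j x) = \int[mu]_(x in D) f x)%E.
Proof.
move=> mj muE mD mf f0.
transitivity (\int[pushforward mu' j]_(x in D) f x)%E; last first.
  apply: eq_measure_integral => C mC _; exact: muE.
rewrite ge0_integral_pushforward//; exact: measurable_funTS.
Qed.

(** Completing a measure does not change integrals, even if the integrand u and
    the domain A on the complete side are only known up to a null set.  The
    sigma-algebras live on two types related by j because the completions in
    use carry their own copy of the underlying type; there j is the identity. *)
Lemma integral_completion d d' (T : measurableType d) (T' : measurableType d')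
    (R : realType) (mu : {measure set T -> \bar R})
    (mu' : {measure set T' -> \bar R}) (j : T' -> T)
    (u : T' -> R) (h : T -> R) (A : set T') (B N : set T) :
  measurable_fun setT j -> measure_is_complete mu' ->
  (forall C, measurable C -> mu' (j @^-1` C) = mu C) ->
  measurable_fun setT h -> (forall x, 0 <= u x) -> (forall x, 0 <= h x) ->
  measurable B -> measurable N -> mu N = 0%E ->
  (forall x, ~ N (j x) -> u x = h (j x)) ->
  eq_off (j @^-1` N) A (j @^-1` B) ->
  (\int[mu']_(x in A) (u x)%:E = \int[mu]_(x in B) (h x)%:E)%E.
Proof.
move=> mj cmu' muE mh u0 h0 mB mN N0 uh AB.
have mpre C : measurable C -> measurable (j @^-1` C).
  by move=> mC; rewrite -[X in measurable X]setTI; exact: mj.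
have mfun_ae (a b : T' -> \bar R) : measurable_fun setT b ->
    (forall x, ~ N (j x) -> a x = b x) -> measurable_fun setT a.
  move=> mb ab _ Y mY; rewrite setTI.
  have -> : a @^-1` Y = (b @^-1` Y `\` j @^-1` N) `|` (a @^-1` Y `&` j @^-1` N).
    apply/seteqP; split=> [x /= Yx|x /= [[Yx Nx]|[]//]]; last by rewrite ab.
    by have [Nx|Nx] := pselect (N (j x)); [right|left; rewrite -ab].
  apply: measurableU.
    by apply: measurableD; [rewrite -[X in measurable X]setTI; exact: mb|exact: mpre].
  apply: cmu'; exists (j @^-1` N); split; [exact: mpre|by rewrite muE|].
  exact: subIsetr.
have mhj : measurable_fun setT (fun x => (h (j x))%:E).
  by apply/measurable_EFinP; exact: measurableT_comp.
rewrite integral_mkcond.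
transitivity (\int[mu']_x (((fun x => (h (j x))%:E) \_ (j @^-1` B)) x))%E.
  have mb : measurable_fun setT ((fun x => (h (j x))%:E) \_ (j @^-1` B)).
    apply/(measurable_restrictT _ _).1; [exact: mpre|exact: measurable_funTS].
  have ab x : ~ N (j x) -> ((EFin \o u) \_ A) x =
      ((fun x => (h (j x))%:E) \_ (j @^-1` B)) x.
    move=> Nx; rewrite !patchE /=; have := AB x Nx.
    case: ifPn => [/set_mem Ax|/negP nA] AiffB.
      by rewrite mem_set ?uh//; exact/AiffB.
    by rewrite memNset// => /AiffB Ax; apply: nA; exact: mem_set.
  apply: ge0_ae_eq_integral => //.
  - exact: mfun_ae mb ab.
  - by move=> x _; apply: erestrict_ge0 => y _ /=; rewrite lee_fin.
  - by move=> x _; apply: erestrict_ge0 => y _ /=; rewrite lee_fin.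
  - exists (j @^-1` N); split; [exact: mpre|by rewrite muE|].
    by move=> x /= xP; apply: contrapT => Nx; apply: xP => _; exact: ab.
rewrite -integral_mkcond.
apply: (ge0_integral_preserving mj muE mB (f := fun x => (h x)%:E)).
- exact/measurable_EFinP.
- by move=> x; rewrite lee_fin.
Qed.

(** * Symmetrization on the line *)

Lemma ereal_between (R : realType) (x y : \bar R) : (x < y)%E ->
  exists2 z, (x < z)%E & (z < y)%E.
Proof.
case: x y => [x| |] [y| |] //.
- rewrite lte_fin => xy; exists ((x + y) / 2)%:E; rewrite lte_fin; lra.
- by move=> _; exists (x + 1)%:E; rewrite ?ltry// lte_fin ltrDl.
- by move=> _; exists (y - 1)%:E; rewrite ?ltNyr// lte_fin gtrBl.
- by move=> _; exists 0%:E; rewrite ?ltry ?ltNyr.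
Qed.

Section half_line_integral.
Context {R : realType}.
Variable h : R -> R.
Hypotheses (mh : measurable_fun setT h) (h0 : forall t, 0 <= h t).
Hypothesis hfin : (\int[lebesgue_measure]_t (h t)%:E < +oo)%E.
Local Open Scope ereal_scope.

Definition tail_integral (c : \bar R) :=
  \int[lebesgue_measure]_(t in half_line 1%R c) (h t)%:E.

Lemma half_lineE (c : \bar R) (t : R) : half_line 1%R c t = (c <= t%:E).
Proof. by rewrite /half_line/= mul1r. Qed.

Lemma measurable_half_line (c : \bar R) :
  measurable (half_line 1%R c : set (measurableTypeR R)).
Proof.
rewrite (_ : half_line _ _ = EFin @^-1` `[c, +oo[%classic); last first.
  by apply/seteqP; split => t /=; rewrite half_lineE in_itv/= andbT.
rewrite -[X in measurable X]setTI.
have mE : measurable_fun (setT : set (measurableTypeR R)) (@EFin R).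
  exact/measurable_EFinP.
apply: mE => //; exact: emeasurable_itv.
Qed.

Let mEh : measurable_fun (setT : set (measurableTypeR R)) (EFin \o h).
Proof. exact/measurable_EFinP. Qed.

Lemma le_tail (c c' : \bar R) : c <= c' -> tail_integral c' <= tail_integral c.
Proof.
move=> cc'; apply: ge0_subset_integral.
- exact: measurable_half_line.
- exact: measurable_half_line.
- exact: measurable_funTS.
- by move=> t _; rewrite lee_fin.
- by move=> t; rewrite !half_lineE; exact: le_trans.
Qed.

(** Dominated convergence: if [u n] tends to c, the indicators of the half-lines
    converge at every point but c.  Treating c in the extended line covers the
    behaviour at -oo and +oo at the same time. *)
Lemma cvg_tail (u : (\bar R)^nat) (c : \bar R) :
  u @ \oo --> c -> (fun n => tail_integral (u n)) @ \oo --> tail_integral c.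
Proof.
move=> uc; rewrite /tail_integral integral_mkcond.
under eq_fun do rewrite integral_mkcond.
have ih : lebesgue_measure.-integrable setT (EFin \o h).
  apply/integrableP; split => //; under eq_integral => x _ do
    rewrite /= ger0_norm//.
  exact: hfin.
have mpatch (d : \bar R) : measurable_fun setT ((EFin \o h) \_ (half_line 1%R d)).
  apply/(measurable_restrictT _ _).1; first exact: measurable_half_line.
  exact: measurable_funTS.
have bounded_patch : {ae lebesgue_measure, forall t, forall n, setT t ->
    `|((EFin \o h) \_ (half_line 1%R (u n))) t| <= (EFin \o h) t}.
  apply: aeW => t n _; rewrite patchE; case: ifPn => _ /=.
    by rewrite ger0_norm.
  by rewrite normr0 lee_fin.
have cvg_patch : {ae lebesgue_measure, forall t, setT t ->
    ((EFin \o h) \_ (half_line 1%R (u n))) t @[n --> \oo] -->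
    ((EFin \o h) \_ (half_line 1%R c)) t}.
  (* For infinite c, [fine c] is the default 0; a single point is null anyway. *)
  exists [set fine c]; split => //; first by rewrite /= lebesgue_measure_set1.
  move=> t /= ; apply: contra_notP => /= tc _.
  have patch_near (b : bool) :
      (\forall n \near \oo, (u n <= t%:E) = b) -> (c <= t%:E) = b ->
      ((EFin \o h) \_ (half_line 1%R (u n))) t @[n --> \oo] -->
      ((EFin \o h) \_ (half_line 1%R c)) t.
    move=> ub cb; apply: cvg_near_cst; near=> n; rewrite !patchE.
    suff -> : (t \in half_line 1%R (u n)) = (t \in half_line 1%R c) by [].
    have un : (u n <= t%:E) = b by near: n.
    by apply: asbool_equiv_eq; rewrite !half_lineE un cb.
  have [ct|tc'|ct] := ltgtP c t%:E.
  + apply: (patch_near true); last exact: ltW.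
    have ut : \forall n \near \oo, u n < t%:E.
      apply: (uc [set x | x < t%:E]); apply: open_nbhs_nbhs; split => //.
      exact: open_ereal_lt_ereal.
    by apply: filterS ut => n /= /ltW.
  + apply: (patch_near false); last by rewrite leNgt tc'.
    have ut : \forall n \near \oo, t%:E < u n.
      apply: (uc [set x | t%:E < x]); apply: open_nbhs_nbhs; split => //.
      exact: open_ereal_gt_ereal.
    by apply: filterS ut => n /=; rewrite ltNge => /negbTE.
  + by exfalso; apply: tc; rewrite ct.
by have [] := @dominated_convergence _ (measurableTypeR R) R lebesgue_measure
  setT measurableT _ _ _ (fun n => mpatch (u n)) (mpatch c) cvg_patch ih
  bounded_patch.
Unshelve. all: by end_near. Qed.

(** The infimum c of the levels whose tail has mass at most m does the job:
    approaching c from inside this set gives a mass at most m, approaching it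
    from below, where tails have mass more than m, gives a mass at least m (if c
    is -oo, this is the hypothesis on m). *)
Lemma exists_smallest_tail (m : \bar R) : 0 <= m -> m <= tail_integral -oo ->
  exists c, is_smallest [set c | m = tail_integral c] c.
Proof.
move=> m0 mtop; pose C := [set c | tail_integral c <= m].
have CN0 : C != set0.
  apply/set0P; exists +oo; rewrite /C/= /tail_integral (_ : half_line _ _ = set0).
    by rewrite integral_set0.
  by apply/seteqP; split => t //; rewrite half_lineE.
exists (ereal_inf C); split; last first.
  by move=> c /= mc; apply: ereal_inf_lbound; rewrite /C/= -mc.
apply/eqP; rewrite eq_le; apply/andP; split.
  have [->//|infC] := eqVneq (ereal_inf C) -oo.
  have [] := @ereal_sup_seq R [set c | c < ereal_inf C].
    by apply/set0P; exists -oo => /=; rewrite ltNye.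
  move=> u uC; have -> : ereal_sup [set c | c < ereal_inf C] = ereal_inf C.
    apply/eqP; rewrite eq_le; apply/andP; split.
      by apply: ge_ereal_sup => c /= /ltW.
    rewrite leNgt; apply/negP => /ereal_between[z xz zy].
    by have := xz; rewrite ltNge => /negP; apply; exact: ereal_sup_ubound.
  move=> /cvg_tail utail; rewrite -(cvg_lim _ utail)//.
  apply: lime_ge; first by apply/cvg_ex; eexists; exact: utail.
  apply: nearW => n; rewrite leNgt; apply/negP => /ltW.
  move=> uCn; have := uC n; rewrite /= ltNge => /negP; apply.
  exact: ereal_inf_lbound.
have [u uC] := ereal_inf_seq CN0.
move=> /cvg_tail utail; rewrite -(cvg_lim _ utail)//.
apply: lime_le; first by apply/cvg_ex; eexists; exact: utail.
by apply: nearW => n; exact: uC.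
Qed.

(** The smallest level c satisfies c <= t exactly when the tail at t has mass at
    most that of A: one direction is the monotonicity of tails; for the other,
    t < c would make the tail at t at least as heavy as the one at c, hence of
    the same mass, against the minimality of c. *)
Lemma ehrhard_sym1E (u : R -> R) (A B N : set R) (t : R) :
  (forall s, 0 <= u s)%R ->
  measurable (B : set (measurableTypeR R)) ->
  measurable (N : set (measurableTypeR R)) -> lebesgue_measure N = 0 ->
  (forall s, ~ N s -> u s = h s) -> eq_off N A B ->
  ehrhard_sym1 u 1 A t <->
  tail_integral t%:E <= \int[lebesgue_measure]_(s in B) (h s)%:E.
Proof.
move=> u0 mB mN N0 uh AB.
have densE (A' B' : set R) : measurable (B' : set (measurableTypeR R)) ->
    eq_off N A' B' ->
    density_measure u A' = \int[lebesgue_measure]_(s in B') (h s)%:E.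
  move=> mB' AB'; apply: (@integral_completion _ _ (measurableTypeR R) _ R
    lebesgue_measure completed_lebesgue_measure id u h A' B' N) => //.
  - move=> _ Y mY; rewrite setTI preimage_id.
    exact: (@sub_caratheodory _ _ R (wlength idfun)).
  - exact: completed_lebesgue_measure_is_complete.
have tailE c : density_measure u (half_line 1%R c) = tail_integral c.
  by apply: densE => //; exact: measurable_half_line.
set m := \int[lebesgue_measure]_(s in B) (h s)%:E.
rewrite /ehrhard_sym1/= (_ : density_measure u A = m); last exact: densE.
have -> : [set c | m = density_measure u (half_line 1%R c)] = [set c | m = tail_integral c].
  by apply/seteqP; split => c /=; rewrite tailE.
have m0 : 0 <= m by apply: integral_ge0 => s _; rewrite lee_fin.
have mtop : m <= tail_integral -oo.
  apply: ge0_subset_integral => //.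
  - exact: measurable_half_line.
  - exact: measurable_funTS.
  - by move=> s _; rewrite lee_fin.
  - by move=> s _; rewrite half_lineE leNye.
split.
  move=> [c [/= -> _]]; rewrite half_lineE; exact: le_tail.
move=> tm; have [c [mc cmin]] := exists_smallest_tail m0 mtop.
exists c; first by split.
rewrite half_lineE leNgt; apply/negP => tc.
have : c <= t%:E; last by rewrite leNgt tc.
apply: cmin => /=; apply/eqP; rewrite eq_le tm andbT mc.
exact/le_tail/ltW.
Qed.

End half_line_integral.

(** * Translations and integration along lines *)

Lemma measurable_translate_R (R : realType) (a : R) :
  measurable_fun setT (fun s : measurableTypeR R => (s + a : measurableTypeR R)).
Proof. exact: (@measurable_funD _ _ R setT id (cst a)). Qed.

Lemma lebesgue_measure_translate (R : realType) (a : R) (A : set R) :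
  measurable (A : set (measurableTypeR R)) ->
  lebesgue_measure ((fun s : R => s + a) @^-1` A) = lebesgue_measure A.
Proof.
move=> mA; apply/esym.
have := @lebesgue_measure_unique R
  (pushforward lebesgue_measure (fun s : measurableTypeR R => (s + a : measurableTypeR R))).
apply => //; first exact: measurable_translate_R.
move=> mt _ [[x y]] _ <-; transitivity (lebesgue_measure (`]x - a, y - a]%classic : set R)).
  rewrite !lebesgue_measure_itv/= !lte_fin ltrD2r; case: ifPn => // _.
  by rewrite -!EFinD; congr EFin; ring.
rewrite /pushforward; congr lebesgue_measure; apply/seteqP; split => s /=;
  by rewrite !in_itv/= ltrBlDr lerBrDr.
Qed.

Section lines.
Context {R : realType}.

Definition line (n : nat) (v x : 'rV[R]_n) (s : measurableTypeR R) : 'rV[R]_n :=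
  x + s *: v.

Lemma measurable_line (n : nat) (v : 'rV[R]_n) :
  measurable_fun setT (fun p : measurableTypeR R * 'rV[R]_n => line v p.2 p.1).
Proof.
apply: measurable_fun_coordvP => i.
rewrite (_ : _ \o _ = (fun p : measurableTypeR R * 'rV[R]_n =>
    coordv i p.2 + p.1 * v 0 i)); last first.
  by apply/funext => p; rewrite /= /line /coordv !mxE.
apply: measurable_funD; first by apply: measurableT_comp => //; exact: measurable_coordv.
by apply: measurable_funM => //; exact: measurable_fst.
Qed.

Lemma measurable_line1 (n : nat) (v x : 'rV[R]_n) : measurable_fun setT (line v x).
Proof. exact: (measurableT_comp (measurable_line v) (pair2_measurable x)). Qed.

Lemma measurable_translate_rV (n : nat) (w : 'rV[R]_n) :
  measurable_fun setT (fun x : 'rV[R]_n => x + w).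
Proof.
have := measurableT_comp (measurable_line w) (pair1_measurable (1%R : measurableTypeR R)).
by apply: eq_measurable_fun => x _; rewrite /= /line scale1r.
Qed.

(** Induction on the dimension: translating a set of R x R^n shifts its sections
    and translates each of them. *)
Lemma borel_lebesgue_translate (n : nat) (w : 'rV[R]_n) (A : set 'rV[R]_n) :
  measurable A -> borel_lebesgue n ((fun x => x + w) @^-1` A) = borel_lebesgue n A.
Proof.
elim: n w A => [|n IH] w A mA.
  congr (borel_lebesgue 0 _); apply/seteqP; split => x /=;
    by rewrite (_ : x + w = x)//; apply/rowP; case.
rewrite /= /lebesgue_succ /pushforward.
pose w' : 'rV[R]_n := \row_j w 0 (lift ord0 j).
set D := @consv R n @^-1` A.
have mD : measurable D by rewrite -[X in measurable X]setTI; exact: measurable_consv.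
rewrite (_ : _ @^-1` (_ @^-1` A) =
    [set p : measurableTypeR R * 'rV[R]_n | D (p.1 + w 0 ord0, p.2 + w')]); last first.
  apply/funext => -[a x]; rewrite /D/=; congr A; apply/rowP => i.
  case: (unliftP ord0 i) => [k ->|->]; rewrite !mxE ?liftK ?unlift_none//=.
  by rewrite !mxE.
rewrite /product_measure1.
rewrite -(@ge0_integral_preserving _ _ _ _ R lebesgue_measure lebesgue_measure
  (fun s : measurableTypeR R => (s + w 0 ord0 : measurableTypeR R))
  (borel_lebesgue n \o xsection D) setT).
- rewrite preimage_setT; apply: eq_integral => a _ /=.
  rewrite -(IH w' (xsection D (a + w 0 ord0))); last exact: measurable_xsection.
  by congr (borel_lebesgue n _); apply/seteqP; split => x;
    rewrite /xsection/= !inE.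
- exact: measurable_translate_R.
- by move=> C mC; exact: lebesgue_measure_translate.
- exact: measurableT.
- exact: measurable_fun_xsection.
- by move=> x; exact: measure_ge0.
Qed.

Variables (n : nat) (v : 'rV[R]_n).

(** For fixed s, x |-> x + s v preserves Lebesgue measure; Tonelli's theorem
    turns this into a statement about the lines through x. *)
Lemma ge0_integral_lines (f : measurableTypeR R * 'rV[R]_n -> \bar R) :
  measurable_fun setT f -> (forall p, 0 <= f p)%E ->
  (\int[borel_lebesgue n]_x \int[lebesgue_measure]_s f (s, line v x s) =
   \int[borel_lebesgue n]_y \int[lebesgue_measure]_s f (s, y))%E.
Proof.
move=> mf f0.
have mF : measurable_fun setT
    (fun p : measurableTypeR R * 'rV[R]_n => f (p.1, line v p.2 p.1)).
  apply: measurableT_comp => //; apply: measurable_fun_pair.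
    exact: measurable_fst.
  exact: measurable_line.
rewrite -(fubini_tonelli (m1 := lebesgue_measure) (m2 := borel_lebesgue n) _ mF)//=.
rewrite -(fubini_tonelli (m1 := lebesgue_measure) (m2 := borel_lebesgue n) _ mf)//=.
apply: eq_integral => s _.
have := @ge0_integral_preserving _ _ _ _ R (borel_lebesgue n) (borel_lebesgue n)
  (fun x => x + s *: v) (fun y => f (s, y)) setT.
rewrite preimage_setT; apply => //.
- exact: measurable_translate_rV.
- by move=> C; exact: borel_lebesgue_translate.
- by apply: (measurableT_comp mf); exact: pair1_measurable.
Qed.

Lemma measurable_line_integral (g : 'rV[R]_n -> R)
    (C : set (measurableTypeR R * 'rV[R]_n)) :
  measurable_fun setT g -> (forall x, 0 <= g x) -> measurable C ->
  measurable_fun setT (fun x : 'rV[R]_n =>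
    \int[lebesgue_measure]_(s in ysection C x) (g (line v x s))%:E)%E.
Proof.
move=> mg g0 mC.
pose G := (fun p : measurableTypeR R * 'rV[R]_n => (g (line v p.2 p.1))%:E) \_ C.
have mG : measurable_fun setT G.
  apply/(measurable_restrictT _ _).1 => //; apply: measurable_funTS.
  apply/measurable_EFinP; apply: measurableT_comp => //; exact: measurable_line.
have G0 p : (0 <= G p)%E by apply: erestrict_ge0 => q _; rewrite lee_fin.
apply: eq_measurable_fun (measurable_fun_fubini_tonelli_G
  (m1 := lebesgue_measure) _ mG G0) => x _.
rewrite /fubini_G [RHS]integral_mkcond; apply: eq_integral => s _.
by rewrite /G !patchE mem_ysection.
Qed.

(** Apply [ge0_integral_lines] to (s, y) |-> 1_N(y), whose integral along
    s |-> (s, y) vanishes unless y is in N. *)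
Lemma ae_null_lines (N : set 'rV[R]_n) : measurable N ->
  borel_lebesgue n N = 0%E ->
  {ae borel_lebesgue n, forall x, lebesgue_measure (line v x @^-1` N) = 0%E}.
Proof.
move=> mN N0.
have mf : measurable_fun setT
    (fun p : measurableTypeR R * 'rV[R]_n => (\1_N p.2 : R)%:E).
  apply/measurable_EFinP.
  exact: (measurableT_comp ((measurable_indicP R N).1 mN) measurable_snd).
have mline x : measurable (line v x @^-1` N).
  by rewrite -[X in measurable X]setTI; exact: measurable_line1.
have lineE x : (\int[lebesgue_measure]_s (\1_N (line v x s) : R)%:E =
    lebesgue_measure (line v x @^-1` N))%E.
  by rewrite -[in RHS](setIT (_ @^-1` _)) -integral_indic.
have int0 : (\int[@borel_lebesgue R n]_x (@lebesgue_measure R) (line v x @^-1` N) = 0)%E.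
  under eq_integral do rewrite -lineE.
  rewrite (ge0_integral_lines mf)/=; last by move=> p; rewrite lee_fin.
  transitivity (\int[@borel_lebesgue R n]_y cst 0%E y)%E; last exact: integral0.
  apply: ge0_ae_eq_integral => //.
  - exact: (measurable_fun_fubini_tonelli_G _ mf).
  - by move=> x _; apply: integral_ge0 => s _; rewrite lee_fin.
  - exists N; split => // x /=; apply: contra_notP => Nx _.
    by under eq_integral do rewrite indicE memNset//; rewrite integral0.
have : ae_eq (borel_lebesgue n) setT (fun x =>
    (@lebesgue_measure R) (line v x @^-1` N)) (cst 0%E).
  apply/ae_eq_integral_abs => //.
    have mC : measurable [set p : measurableTypeR R * 'rV[R]_n | N (line v p.2 p.1)].
      by rewrite -[X in measurable X]setTI; exact: measurable_line.
    apply: eq_measurable_fun (measurable_fun_ysection lebesgue_measure mC) => x _.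
    by rewrite /=; congr lebesgue_measure; apply/seteqP; split => s;
      rewrite /ysection/= inE.
  by rewrite -[RHS]int0; apply: eq_integral => x _; rewrite gee0_abs.
by apply: filterS => x; apply.
Qed.

(** The integral of g over all lines through all points of R^n diverges, unless
    g vanishes almost everywhere, since each line has infinitely many base
    points.  Keeping only the base points x in the slab |x_i| <= j |v_i| makes
    it finite: a given y lies on a line based at x = y - s v in this slab only
    for s in an interval of length 2 j, so the restricted integral is at most
    2 j times that of g.  The slabs exhaust R^n. *)
Lemma ae_fin_line_integral (g : 'rV[R]_n -> R) (i : 'I_n) : v 0 i != 0 ->
  measurable_fun setT g -> (forall x, 0 <= g x) ->
  (\int[borel_lebesgue n]_x (g x)%:E < +oo)%E ->
  {ae borel_lebesgue n, forall x,
    (\int[lebesgue_measure]_s (g (line v x s))%:E < +oo)%E}.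
Proof.
move=> vi0 mg g0 gfin.
pose K (j : nat) : set 'rV[R]_n := [set x | `|x 0 i| <= j%:R * `|v 0 i|].
(* Evaluated at (s, x + s v), f j is g on the line times the indicator of x. *)
pose f j (p : measurableTypeR R * 'rV[R]_n) : \bar R :=
  (g p.2 * \1_(K j) (line v p.2 (- p.1)))%:E.
have mK j : measurable (K j).
  rewrite (_ : K j = setT `&` @coordv R n i @^-1` `[- (j%:R * `|v 0 i|), j%:R * `|v 0 i|]%classic).
    exact: measurable_coordv.
  by rewrite setTI; apply/seteqP; split => x;
    rewrite /K /coordv /= in_itv/= ler_norml.
have mf j : measurable_fun setT (f j).
  apply/measurable_EFinP; apply: measurable_funM.
    exact: measurableT_comp.
  apply: (measurableT_comp ((measurable_indicP R _).1 (mK j))).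
  apply: (measurableT_comp (measurable_line v) (_ : measurable_fun _
    (fun p : measurableTypeR R * 'rV[R]_n => (- p.1 : measurableTypeR R, p.2)))).
  apply: measurable_fun_pair => //; apply: measurable_funN; exact: measurable_fst.
have f0 j p : (0 <= f j p)%E by rewrite lee_fin mulr_ge0.
have slab j y : (\int[lebesgue_measure]_s f j (s, y) <=
    (j%:R *+ 2)%:E * (g y)%:E)%E.
  pose I := `[y 0 i / v 0 i - j%:R, y 0 i / v 0 i + j%:R]%classic : set R.
  have fE s : f j (s, y) = ((g y)%:E * (\1_I s)%:E)%E.
    rewrite /f /= -EFinM; congr (_ * _)%:E; rewrite !indicE.
    congr (nat_of_bool _)%:R; apply: asbool_equiv_eq.
    rewrite /K /I /line /= !mxE in_itv/=.
    rewrite (_ : y 0 i + - s * v 0 i = (y 0 i / v 0 i - s) * v 0 i); last by field.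
    rewrite normrM ler_pM2r ?normr_gt0// distrC ler_distl.
    by split.
  under eq_integral do rewrite fE.
  have mI : measurable (I : set (measurableTypeR R)) by exact: measurable_itv.
  have mEI : measurable_fun (setT : set (measurableTypeR R)) (fun s => (\1_I s : R)%:E).
    by apply/measurable_EFinP; exact/measurable_indicP.
  rewrite ge0_integralZl_EFin//.
  have leI : (lebesgue_measure (I : set R) <= (j%:R *+ 2)%:E)%E.
    rewrite lebesgue_measure_itv/=; case: ifPn => _.
      by rewrite -EFinB lee_fin mulr2n; lra.
    by rewrite lee_fin mulrn_wge0.
  rewrite integral_indic// setIT muleC; apply: lee_wpmul2r; last exact: leI.
  by rewrite lee_fin.
have Kfin j : {ae borel_lebesgue n, forall x, K j x ->
    (\int[lebesgue_measure]_s (g (line v x s))%:E < +oo)%E}.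
  have fE x s : f j (s, line v x s) = (\1_(K j) x * g (line v x s))%:E.
    by rewrite /f /= mulrC (_ : line v _ _ = x)// /line scaleNr addrK.
  pose H x := (\int[lebesgue_measure]_s f j (s, line v x s))%E.
  have iH : (borel_lebesgue n).-integrable setT H.
    apply/integrableP; split.
      apply: (measurable_fun_fubini_tonelli_G (m1 := lebesgue_measure)
        (fun p : measurableTypeR R * 'rV[R]_n => f j (p.1, line v p.2 p.1))) => //.
      apply: measurableT_comp => //; apply: measurable_fun_pair.
        exact: measurable_fst.
      exact: measurable_line.
    under eq_integral => x _ do rewrite gee0_abs ?integral_ge0//.
    rewrite (ge0_integral_lines (mf j)) ?f0//.
    have mEg : measurable_fun setT (fun y => (g y)%:E) by exact/measurable_EFinP.
    apply: (@le_lt_trans _ _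
      (\int[@borel_lebesgue R n]_y ((j%:R *+ 2)%:E * (g y)%:E))%E).
      apply: ge0_le_integral => //.
      - by move=> y _; apply: integral_ge0.
      - exact: (measurable_fun_fubini_tonelli_G _ (mf j) (f0 j)).
      - by apply: measurable_funeM.
    rewrite ge0_integralZl_EFin ?mulrn_wge0//.
      by rewrite lte_mul_pinfty// ?lee_fin ?mulrn_wge0.
    by move=> y _; rewrite lee_fin.
  apply: filterS (integrable_ae measurableT iH) => x Hx Kx.
  have := Hx Logic.I; rewrite ge0_fin_numE; last exact: integral_ge0.
  rewrite /H; under eq_integral do rewrite fE indicE mem_set// mul1r.
  by [].
apply: filterS (ae_foralln Kfin) => x Kx.
apply: (Kx (Num.bound (`|x 0 i| / `|v 0 i|))).
rewrite /K/= -ler_pdivrMr ?normr_gt0//; apply/ltW.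
by apply: archi_boundP; rewrite divr_ge0.
Qed.

End lines.

(** * Symmetrization in R^n *)

Lemma dotvDl (R : realType) (n : nat) (x y v : 'rV[R]_n) :
  dotv (x + y) v = dotv x v + dotv y v.
Proof. by rewrite /dotv -big_split/=; apply: eq_bigr => i _; rewrite mxE mulrDl. Qed.

Lemma dotvZl (R : realType) (n : nat) (a : R) (x v : 'rV[R]_n) :
  dotv (a *: x) v = a * dotv x v.
Proof. by rewrite /dotv mulr_sumr; apply: eq_bigr => i _; rewrite mxE mulrA. Qed.

Lemma enorm_eq1 (R : realType) (n : nat) (v : 'rV[R]_n) : enorm v = 1 -> dotv v v = 1.
Proof.
move=> v1; rewrite -(sqr_sqrtr (a := dotv v v)) -/(enorm v) ?v1 ?expr1n//.
by apply: sumr_ge0 => i _; rewrite -expr2 sqr_ge0.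
Qed.

(** Every y lies on exactly one fibre x + R v with x orthogonal to v: that of
    its projection, where its parameter is the coordinate of y along v. *)
Lemma ehrhard_sym_fibre (R : realType) (n : nat) (f : 'rV[R]_n -> R)
    (v : 'rV[R]_n) (E : set 'rV[R]_n) (y : 'rV[R]_n) : dotv v v = 1 ->
  ehrhard_sym f v E y <->
  ehrhard_sym1 (f \o line v (y - dotv y v *: v)) 1
    (line v (y - dotv y v *: v) @^-1` E) (dotv y v).
Proof.
move=> vv; pose x := y - dotv y v *: v; rewrite -/x; split.
  move=> [x' x'v [t symt xty]].
  have ty : t = dotv y v by rewrite -xty dotvDl dotvZl x'v vv add0r mulr1.
  have xx' : x = x' by rewrite /x -ty -xty addrK.
  by rewrite xx' -ty.
move=> symx; exists x.
  by rewrite /orthv/= /x dotvDl -scaleNr dotvZl vv mulr1 subrr.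
by exists (dotv y v) => //; rewrite /x subrK.
Qed.

(** The description of the symmetrized set free of the level c.  The fibre of y
    is parametrized from the projection of y in the definition, and from y
    itself here; a translation of the line passes from one to the other. *)
Lemma ehrhard_symE (R : realType) (n : nat) (f g : 'rV[R]_n -> R)
    (v : 'rV[R]_n) (E B N : set 'rV[R]_n) (y : 'rV[R]_n) :
  dotv v v = 1 -> measurable_fun setT g ->
  (forall x, 0 <= f x) -> (forall x, 0 <= g x) ->
  measurable B -> measurable N ->
  (forall x, ~ N x -> f x = g x) -> eq_off N E B ->
  lebesgue_measure (line v y @^-1` N) = 0%E ->
  (\int[lebesgue_measure]_s (g (line v y s))%:E < +oo)%E ->
  ehrhard_sym f v E y <->
  (\int[lebesgue_measure]_(s in (`[0%R, +oo[%classic : set R)) (g (line v y s))%:E <=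
   \int[lebesgue_measure]_(s in line v y @^-1` B) (g (line v y s))%:E)%E.
Proof.
move=> vv mg f0 g0 mB mN fg EB N0 gfin.
set t := dotv y v; pose x := y - t *: v.
pose tr (s : measurableTypeR R) : measurableTypeR R := s - t.
have lineE s : line v x s = line v y (tr s).
  by rewrite /line /x /tr scalerBl addrAC addrA.
have mtr : measurable_fun setT tr by exact: measurable_translate_R.
have mpre (C : set 'rV[R]_n) (z : 'rV[R]_n) : measurable C -> measurable (line v z @^-1` C).
  by move=> mC; rewrite -[X in measurable X]setTI; exact: measurable_line1.
have lineC (C : set 'rV[R]_n) : line v x @^-1` C = tr @^-1` (line v y @^-1` C).
  by apply/seteqP; split => s /=; rewrite lineE.
have mgy : measurable_fun setT (fun s => (g (line v y s))%:E).
  by apply/measurable_EFinP; apply: measurableT_comp => //; exact: measurable_line1.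
have trE (D : set (measurableTypeR R)) : measurable D ->
    (\int[lebesgue_measure]_(s in tr @^-1` D) (g (line v x s))%:E =
     \int[lebesgue_measure]_(s in D) (g (line v y s))%:E)%E.
  move=> mD; rewrite -(@ge0_integral_preserving _ _ _ _ R lebesgue_measure
    lebesgue_measure tr (fun s => (g (line v y s))%:E))//.
  - by apply: eq_integral => s _; rewrite lineE.
  - by move=> C mC; exact: lebesgue_measure_translate.
  - by move=> s; rewrite lee_fin.
apply: (iff_trans (ehrhard_sym_fibre f E y vv)); rewrite -/t -/x.
have hfin : (\int[lebesgue_measure]_s (g (line v x s))%:E < +oo)%E.
  by have := trE setT measurableT; rewrite preimage_setT => ->.
apply: (iff_trans (@ehrhard_sym1E R (g \o line v x) _ _ hfin (f \o line v x)
  (line v x @^-1` E) (line v x @^-1` B) (line v x @^-1` N) t _ _ _ _ _ _)) => //.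
- exact: (measurableT_comp mg (measurable_line1 v x)).
- by move=> s; exact: g0.
- by move=> s; exact: f0.
- exact: mpre.
- exact: mpre.
- by rewrite lineC lebesgue_measure_translate//; exact: mpre.
- by move=> s; exact: fg.
- by move=> s; exact: EB.
rewrite /tail_integral lineC trE; last exact: mpre.
rewrite (_ : half_line 1 t%:E = tr @^-1` `[0%R, +oo[%classic); last first.
  by apply/seteqP; split => s; rewrite half_lineE /tr/= in_itv/= andbT subr_ge0 lee_fin.
by rewrite trE//; exact: measurable_itv.
Qed.

Theorem theorem2p11 (R : realType) (n : nat)
    (mu : {measure set (lebRn R n) -> \bar R}) (f : 'rV[R]_n -> R)
    (hmu : W_class mu f)
    (E : set 'rV[R]_n) (hE : lebesgue_measurable E)
    (v : 'rV[R]_n) (hv : enorm v = 1) :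
  lebesgue_measurable (ehrhard_sym f v E).
Proof.
have [_ f0 intf _ _] := hmu.
have sf := sigma_finiteT (@borel_lebesgue R n).
have vv := enorm_eq1 hv.
have [i vi0] : exists i, v 0 i != 0.
  apply: contrapT => v0; move: vv; rewrite /dotv big1 => [/esym/eqP|i _].
    by rewrite oner_eq0.
  suff -> : v 0 i = 0 by rewrite mul0r.
  by apply/eqP; apply: contrapT => /negP vi0; apply: v0; exists i.
have [B [N1 [mB mN1 N10 EB]]] := caratheodory_eq_off sf hE.
have mf : measurable_fun setT (f : lebRn R n -> R).
  by apply/measurable_EFinP; exact: measurable_int intf.
have [g [N2 [mg mN2 N20 g0 fg]]] := measurable_version sf mf f0.
pose N := N1 `|` N2.
have mN : measurable N by exact: measurableU.
have N0 : borel_lebesgue n N = 0%E.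
  by rewrite measureU0.
have gfin : (\int[borel_lebesgue n]_x (g x)%:E < +oo)%E.
  have <- : (\int[lebesgue R n]_x (f x)%:E = \int[borel_lebesgue n]_x (g x)%:E)%E.
    apply: (@integral_completion _ _ _ _ R (borel_lebesgue n) (lebesgue R n) id
      f g setT setT N2) => //.
    - by move=> _ Y mY; rewrite setTI; exact: caratheodory_measurable_mu_ext.
    - exact: measure_is_complete_caratheodory.
    - by move=> C mC; exact: measurable_mu_extE.
  have /integrableP[_] := intf; apply: le_lt_trans.
  by under [leRHS]eq_integral => x _ do rewrite /= ger0_norm//.
have [M [mM M0 MP]] : {ae borel_lebesgue n, forall x,
    lebesgue_measure (line v x @^-1` N) = 0%E /\
    (\int[lebesgue_measure]_s (g (line v x s))%:E < +oo)%E}.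
  apply: filterS2 (ae_null_lines v mN N0) (ae_fin_line_integral vi0 mg g0 gfin).
  by move=> x; split.
pose P (y : 'rV[R]_n) := (\int[lebesgue_measure]_(s in (`[0%R, +oo[%classic : set R))
  (g (line v y s))%:E)%E.
pose Q (y : 'rV[R]_n) := (\int[lebesgue_measure]_(s in line v y @^-1` B)
  (g (line v y s))%:E)%E.
have mP : measurable_fun setT P.
  have mC : measurable ((`[0%R, +oo[%classic : set (measurableTypeR R)) `*` [set: 'rV[R]_n]).
    by apply: measurableX => //; exact: measurable_itv.
  apply: eq_measurable_fun (measurable_line_integral v mg g0 mC) => x _.
  rewrite /P; congr (integral _ _ _); apply/seteqP; split => s;
    rewrite /ysection/= inE/=; by [case|].
have mQ : measurable_fun setT Q.
  have mC : measurable [set p : measurableTypeR R * 'rV[R]_n | B (line v p.2 p.1)].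
    by rewrite -[X in measurable X]setTI; exact: measurable_line.
  apply: eq_measurable_fun (measurable_line_integral v mg g0 mC) => x _.
  by rewrite /Q; congr (integral _ _ _); apply/seteqP; split => s;
    rewrite /ysection/= inE.
apply: (@eq_off_caratheodory _ _ _ (borel_lebesgue n) _
  [set y | (0 <= Q y - P y)%E] M) => //.
  rewrite -[X in measurable X]setTI; apply: emeasurable_fun_c_infty => //.
  exact: emeasurable_funB.
move=> y My; have [Ny gy] : lebesgue_measure (line v y @^-1` N) = 0%E /\
    (\int[lebesgue_measure]_s (g (line v y s))%:E < +oo)%E.
  by apply: contrapT => nP; apply: My; exact: MP.
apply: (iff_trans (ehrhard_symE vv mg f0 g0 mB mN _ _ Ny gy)).
- by move=> x Nx; apply: fg => N2x; apply: Nx; right.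
- by move=> x Nx; apply: EB => N1x; apply: Nx; left.
rewrite /= sube_ge0 //.
apply/orP; left.
rewrite ge0_fin_numE; last by apply: integral_ge0 => s _; rewrite lee_fin.
apply: le_lt_trans gy; apply: ge0_subset_integral => //.
- by apply/measurable_EFinP; apply: measurableT_comp => //; exact: measurable_line1.
- by move=> s _; rewrite lee_fin.
Qed.
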